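(* Let $m \ge n \ge 1$ be integers. Let $D \subset \mathbb{R}^n$ be an open set whose closure $\overline{D}$ satisfies $\overline{D} \setminus D = \bigsqcup_{j\in J} S_j$ (disjoint union), where $J$ is a finite set and each $S_j$ is an $(n-1)$-dimensional smooth submanifold of $\mathbb{R}^n$ without boundary that is a union of finitely many connected components of the zero set of some smooth function $g_j:\mathbb{R}^n\to\mathbb{R}$ having no critical point on $S_j$. Let $I$ be an interval of the form $I=[a_1,a_2]$ with $a_1<a_2$ real, or $I=[a,\infty)$ with $a$ real, and let $F:\mathbb{R}^n\times I\to\mathbb{R}$ be a smooth function. For $t\in I$ put $F_t(x):=F(x,t)$. Suppose the following. (i) $\overline{D} = \{x\in\mathbb{R}^n \mid F(x,t)=0 \text{ for some } t\in I\}$. (ii) For distinct $t_1,t_2\in I$, the sets $F_{t_1}^{-1}(0)$ and $F_{t_2}^{-1}(0)$ are disjoint. If $I=[a_1,a_2]$, there are subsets $J_1,J_2\subset J$ with $J=J_1\sqcup J_2$ and $F_{a_i}^{-1}(0)=\bigsqcup_{j\in J_i}S_j$ for $i=1,2$, and for $i=1,2$ the function $F_{a_i}$ has no critical point on $F_{a_i}^{-1}(0)$. If $I=[a,\infty)$, then $F_a^{-1}(0)=\bigsqcup_{j\in J}S_j$ and $F_a$ has no critical point on $F_a^{-1}(0)$. (iii) $\frac{\partial F}{\partial t}(x_0,t_0)\neq 0$ for every $(x_0,t_0)\in\mathbb{R}^n\times I$. Then the following hold. (1) If $I=[a,\infty)$ and $G_{+,a}:\mathbb{R}\to\mathbb{R}$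 is a smooth function such that $\{t\mid G_{+,a}(t)>0\}=I\setminus\{a\}$, $G_{+,a}(a)=0$ and $G_{+,a}'(a)\neq 0$, then $$\Big\{(x,t,(y_j)_{j=1}^{m-n+1})\in\mathbb{R}^n\times I\times\mathbb{R}^{m-n+1}\;\Big|\; F(x,t)=0,\ G_{+,a}(t)-\sum_{j=1}^{m-n+1}y_j^2=0\Big\}$$ is an $m$-dimensional smooth submanifold of $\mathbb{R}^{m+2}$ with no boundary. (2) If $I=[a_1,a_2]$ and $G_{+,a_1,a_2}:\mathbb{R}\to\mathbb{R}$ is a smooth function such that $\{t\mid G_{+,a_1,a_2}(t)>0\}=I\setminus\{a_1,a_2\}$, $G_{+,a_1,a_2}(a_i)=0$ and $G_{+,a_1,a_2}'(a_i)\neq 0$ for $i=1,2$, then $$\Big\{(x,t,(y_j)_{j=1}^{m-n+1})\in\mathbb{R}^n\times I\times\mathbb{R}^{m-n+1}\;\Big|\; F(x,t)=0,\ G_{+,a_1,a_2}(t)-\sum_{j=1}^{m-n+1}y_j^2=0\Big\}$$ is an $m$-dimensional smooth submanifold of $\mathbb{R}^{m+2}$ with no boundary.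
   Context: Smooth means $C^\infty$; a function on $\mathbb{R}^n\times I$ is smooth if it extends to a smooth function on an open neighborhood of $\mathbb{R}^n\times I$ in $\mathbb{R}^{n+1}$, and $\partial/\partial t$ at boundary points of $I$ is the corresponding one-sided derivative. A critical point of a real-valued smooth function is a point where its differential vanishes. $\mathbb{R}^n\times\mathbb{R}\times\mathbb{R}^{m-n+1}$ is identified with $\mathbb{R}^{m+2}$. *)

(* Defs.v *)
From HB Require Import structures.
From mathcomp Require Import all_boot all_order all_algebra.
From mathcomp Require Import all_classical all_reals all_analysis.

Set Implicit Arguments.
Unset Strict Implicit.
Unset Printing Implicit Defensive.

Import Order.TTheory GRing.Theory Num.Theory.
Import numFieldNormedType.Exports.

Local Open Scope classical_set_scope.
Local Open Scope ring_scope.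

Definition partial (R : realType) (W : normedModType R) (N : nat) (i : 'I_N)
    (f : 'rV[R]_N -> W) : 'rV[R]_N -> W :=
  fun x => 'D_(delta_mx 0 i) f x.

Definition iter_partial (R : realType) (W : normedModType R) (N : nat)
    (s : seq 'I_N) (f : 'rV[R]_N -> W) : 'rV[R]_N -> W :=
  foldr (@partial R W N) f s.

(* Partial derivatives of all orders exist and are continuous on U.  This is
   only meant for open U: the iterated partials at a point of U then depend on
   the values of f in U only. *)
Definition smooth_on (R : realType) (W : normedModType R) (N : nat)
    (U : set 'rV[R]_N) (f : 'rV[R]_N -> W) : Prop :=
  forall (s : seq 'I_N) (x : 'rV[R]_N), U x ->
    {for x, continuous (iter_partial s f)} /\
    forall i : 'I_N, derivable (iter_partial s f) x (delta_mx 0 i).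

Definition smooth1 (R : realType) (g : R -> R) : Prop :=
  forall (k : nat) (t : R), derivable (derive1n k g) t 1.

(* The values F x t with t outside I are irrelevant. *)
Definition smooth_on_cylinder (R : realType) (n : nat) (I : set R)
    (F : 'rV[R]_n -> R -> R) : Prop :=
  exists (W : set 'rV[R]_(n + 1)) (Fext : 'rV[R]_(n + 1) -> R),
    [/\ open W,
        forall x t, I t -> W (row_mx x t%:M),
        smooth_on W Fext
      & forall x t, I t -> Fext (row_mx x t%:M) = F x t].

(* Difference quotients are restricted to increments h with t + h in I, so
   that this is the one-sided derivative at an end point of an interval I. *)
Definition derive_within (R : realType) (I : set R) (f : R -> R) (t : R) : R :=
  lim ((fun h : R => h^-1 * (f (t + h) - f t))
         @ within [set h | I (t + h)] 0^').

Definition critical_point (R : realType) (n : nat) (g : 'rV[R]_n -> R)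
    (x : 'rV[R]_n) : Prop :=
  forall v : 'rV[R]_n, 'd g x v = 0.

Definition diffeo_between (R : realType) (N : nat) (U V : set 'rV[R]_N)
    (phi : 'rV[R]_N -> 'rV[R]_N) : Prop :=
  exists psi : 'rV[R]_N -> 'rV[R]_N,
    [/\ smooth_on U phi /\ smooth_on V psi,
        phi @` U `<=` V /\ psi @` V `<=` U,
        {in U, cancel phi psi}
      & {in V, cancel psi phi}].

(* Embedded submanifolds without boundary, by slice charts; the empty set is a
   submanifold of every dimension d <= N. *)
Definition smooth_submanifold (R : realType) (N d : nat) (S : set 'rV[R]_N)
    : Prop :=
  (d <= N)%N /\
  forall p, S p ->
    exists (U V : set 'rV[R]_N) (phi : 'rV[R]_N -> 'rV[R]_N),
      [/\ open U /\ U p, open V, diffeo_between U V phi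
        & phi @` (U `&` S) =
          V `&` [set z | forall i : 'I_N, (d <= i)%N -> z 0 i = 0]].

Definition zero_set (R : realType) (T : Type) (g : T -> R) : set T :=
  [set x | g x = 0].

Definition finite_union_of_components (T : topologicalType) (Z S : set T)
    : Prop :=
  exists CC : set (set T),
    [/\ finite_set CC,
        CC `<=` [set connected_component Z x | x in Z]
      & S = \bigcup_(C in CC) C].

Lemma total_dim (m n : nat) (hnm : (n <= m)%N) :
  (n + 1 + (m - n + 1) = m + 2)%N.
Proof. by rewrite addnACA subnKC. Qed.

(* The identification of R^n x R x R^(m-n+1) with R^(m+2). *)
Definition join_coords (R : realType) (m n : nat) (hnm : (n <= m)%N)
    (x : 'rV[R]_n) (t : R) (y : 'rV[R]_(m - n + 1)) : 'rV[R]_(m + 2) :=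
  castmx (erefl 1%N, total_dim hnm) (row_mx (row_mx x t%:M) y).

Definition fibered_set (R : realType) (m n : nat) (hnm : (n <= m)%N)
    (I : set R) (F : 'rV[R]_n -> R -> R) (G : R -> R) : set 'rV[R]_(m + 2) :=
  [set z | exists (x : 'rV[R]_n) (t : R) (y : 'rV[R]_(m - n + 1)),
     [/\ z = join_coords hnm x t y, I t, F x t = 0
       & G t - \sum_(j < m - n + 1) y 0 j ^+ 2 = 0]].

(* Main.v *)
Require Import Defs.
From HB Require Import structures.
From mathcomp Require Import all_boot all_order all_algebra.
From mathcomp Require Import fingroup perm lra.
From mathcomp Require Import all_classical all_reals all_analysis.

Set Implicit Arguments.
Unset Strict Implicit.
Unset Printing Implicit Defensive.

Import Order.TTheory GRing.Theory Num.Theory.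
Import numFieldNormedType.Exports.

Local Open Scope classical_set_scope.
Local Open Scope ring_scope.

(** Both sets are cut out of R^n x R x R^(m-n+1) by the two equations
    F(x,t) = 0 and G(t) - |y|^2 = 0, and the point is that at each of their
    solutions these equations can be solved one after the other, each for one
    coordinate of its own.

    At a solution p = (x,t,y), G(t) = |y|^2 is nonnegative.  If G(t) > 0, then t
    is interior to I and some y_j is nonzero; the second equation is solved for
    y_j (its derivative is -2 y_j) and the first one for t (by assumption the
    derivative of F in t never vanishes), and the first one does not involve y_j.
    If G(t) = 0, then t is an end point of I; the first equation is solved for
    some x_i, as F_t has no critical point on its zero set, and the second one
    for t, as G'(t) is nonzero, and the second one does not involve x_i.  In both
    cases the Jacobian is triangular, so instead of the inverse function theorem
    it is enough to know that z |-> (z with its k-th coordinate replaced by f(z))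
    is a local diffeomorphism where the k-th partial derivative of f is positive
    ([local_chart_set_coord]), which a constant factor achieves when it is
    nonzero.  Composing two such maps and permuting coordinates yields a slice
    chart ([two_equations_submanifold]).

    The restriction t in I is harmless.  Where G(t) > 0 the positivity of G forces
    t in I; near an end point a of I the zero of G at a is simple, hence isolated
    ([isolated_zero]), so that G(t) = |y|^2 >= 0 again forces t in I.

    The one-coordinate straightening is elementary.  Along the k-th coordinate f
    is strictly monotone, so the intermediate value theorem solves f = w_k
    uniquely and continuously ([solves_near]).  Smoothness of the solution follows
    from Caratheodory's form of differentiability,
    f(x) - f(z) = sum_l (x_l - z_l) a_l(x) with a_l continuous at z
    ([caratheodory]): it turns the chain rule and implicit differentiation into
    limits of finite sums of products, and the resulting formula for the partial
    derivatives bootstraps from C^k to C^(k+1) ([Ck_implicit]). *)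

(** * Functions of class C^k *)

(** The recursion peels off the innermost derivative, so that inductions on k may
    replace each first partial derivative by an explicit formula of lower
    regularity; [smooth_onP] relates it to iterated partial derivatives. *)
Fixpoint Ck {R : realType} {N : nat} (k : nat) (U : set 'rV[R]_N)
    (f : 'rV[R]_N -> R) : Prop :=
  (forall x, U x -> {for x, continuous f}) /\
  if k is k'.+1 then
    forall i : 'I_N, (forall x, U x -> derivable f x (delta_mx 0 i)) /\
      Ck k' U (partial i f)
  else True.

Section ClassCk.
Context {R : realType}.

Lemma continuous_rV (T : topologicalType) N (phi : T -> 'rV[R]_N) (z : T) :
  (forall l, {for z, continuous (fun x => phi x 0 l)}) ->
  {for z, continuous phi}.
Proof.
move=> cphi; apply/cvg_ballP => e e0; near=> x; split=> // i j.
rewrite ord1; move: j; near: x; apply: filter_forall => j.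
by exact: (cvg_ball (cphi j)).
Unshelve. all: by end_near. Qed.

Lemma is_derive_line N (f : 'rV[R]_N -> R) (w : 'rV[R]_N) l (s : R) :
  derivable f (w + s *: delta_mx 0 l) (delta_mx 0 l) ->
  is_derive s 1 (fun u : R => f (w + u *: delta_mx 0 l))
    (partial l f (w + s *: delta_mx 0 l)).
Proof.
move=> df.
have E : (fun h : R => h^-1 *: (((fun u => f (w + u *: delta_mx 0 l)) \o shift s)
     (h *: 1%R) - f (w + s *: delta_mx 0 l))) =
  (fun h : R => h^-1 *: ((f \o shift (w + s *: delta_mx 0 l)) (h *: delta_mx 0 l)
     - f (w + s *: delta_mx 0 l))).
  apply/funext => h /=; congr (_ *: (f _ - _)).
  by rewrite [h%:A]mulr1 scalerDl addrCA.
split; first by rewrite /derivable E.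
by rewrite /derive E.
Qed.

(** The intermediate point is u * b with u in [0, 1], whatever the sign of b. *)
Lemma partial_mvt N (f : 'rV[R]_N -> R) (w : 'rV[R]_N) l (b : R) :
  (forall u : R, 0 <= u <= 1 ->
     derivable f (w + (u * b) *: delta_mx 0 l) (delta_mx 0 l)) ->
  exists2 u : R, 0 <= u <= 1 &
   f (w + b *: delta_mx 0 l) - f w =
     partial l f (w + (u * b) *: delta_mx 0 l) * b.
Proof.
move=> df.
pose h (u : R) := f (w + u *: delta_mx 0 l).
have dg (u : R) : 0 <= u <= 1 ->
    is_derive u 1 (h \o *%R^~ b) (partial l f (w + (u * b) *: delta_mx 0 l) * b).
  move=> u01; apply: is_derive1_comp.
    exact: is_derive_line (df _ u01).
  have := is_deriveM (is_derive_id u 1) (is_derive_cst b u 1).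
  by rewrite scaler0 add0r [b%:A]mulr1.
(* The mean value theorem is applied to h on the segment from 0 to b,
   reparametrized over [0, 1]. *)
have ch : {within `[0, 1], continuous (h \o *%R^~ b)}.
  apply: derivable_within_continuous => u; rewrite in_itv /= => u01.
  by have [] := dg u u01.
have [u|u u01 E] := @MVT_segment _ (h \o *%R^~ b)
    (fun u => partial l f (w + (u * b) *: delta_mx 0 l) * b) 0 1 ler01 _ ch.
  by rewrite in_itv /= => /andP[u0 u1]; apply: dg; rewrite !ltW.
exists u; first by rewrite in_itv in u01.
by move: E; rewrite /h /= mul1r mul0r scale0r addr0 subr0 mulr1.
Qed.

Lemma Ck_cont N k (U : set 'rV[R]_N) f x :
  Ck k U f -> U x -> {for x, continuous f}.
Proof. by case: k => [|k] [+ _] => /[apply]. Qed.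

Lemma Ck_derivable N k (U : set 'rV[R]_N) f x i :
  Ck k.+1 U f -> U x -> derivable f x (delta_mx 0 i).
Proof. by move=> [_ /(_ i)[+ _]] => /[apply]. Qed.

Lemma Ck_partial N k (U : set 'rV[R]_N) f i : Ck k.+1 U f -> Ck k U (partial i f).
Proof. by move=> [_ /(_ i)[_]]. Qed.

Lemma Ck_intro N k (U : set 'rV[R]_N) f :
  (forall x, U x -> {for x, continuous f}) ->
  (forall i x, U x -> derivable f x (delta_mx 0 i)) ->
  (forall i, Ck k U (partial i f)) -> Ck k.+1 U f.
Proof. by move=> c d p; split=> // i; split; [exact: d|exact: p]. Qed.

Lemma Ck_pred N k (U : set 'rV[R]_N) f : Ck k.+1 U f -> Ck k U f.
Proof.
elim: k f => [|k IH] f Cf; first by split=> // x; exact: Ck_cont Cf.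
apply: Ck_intro => [x|i x|i]; first exact: Ck_cont Cf.
  exact: Ck_derivable Cf.
exact: IH (Ck_partial _ Cf).
Qed.

Lemma Ck_sub N k (U V : set 'rV[R]_N) f : V `<=` U -> Ck k U f -> Ck k V f.
Proof.
move=> VU; elim: k f => [|k IH] f Cf; first by split=> // x /VU; exact: (Ck_cont Cf).
apply: Ck_intro => [x /VU|i x /VU|i]; first exact: Ck_cont Cf.
  exact: Ck_derivable Cf.
exact: IH (Ck_partial i Cf).
Qed.

Lemma smooth_onP N (U : set 'rV[R]_N) (f : 'rV[R]_N -> R) :
  smooth_on U f <-> forall k, Ck k U f.
Proof.
split=> [sf k|Cf s].
  suff H s : Ck k U (iter_partial s f) by exact: (H [::]).
  elim: k s => [|k IH] s; first by split=> // x /(sf s)[].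
  by apply: Ck_intro => [x /(sf s)[]//|i x /(sf s)[]//|i]; exact: (IH (i :: s)).
have {}Cf k : Ck k U (iter_partial s f).
  elim: s k => [|i s IH] k; first exact: Cf.
  exact: (Ck_partial i (IH k.+1)).
by move=> x Ux; split=> [|i]; [exact: Ck_cont (Cf 0) Ux|exact: Ck_derivable (Cf 1) Ux].
Qed.

Lemma open_near (T : topologicalType) (U : set T) x : open U -> U x -> \near x, U x.
Proof. by move=> oU Ux; exact: open_nbhs_nbhs. Qed.

(** Partial derivatives on an open set depend on the values there only. *)
Lemma Ck_eq N k (U : set 'rV[R]_N) f g : open U ->
  (forall x, U x -> f x = g x) -> Ck k U f -> Ck k U g.
Proof.
move=> oU; elim: k f g => [|k IH] f g fg Cf.
  split=> // x Ux; have cf := Ck_cont Cf Ux.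
  suff: g y @[y --> x] --> g x by [].
  rewrite -(fg x Ux); apply: cvg_trans cf.
  apply: (@near_eq_cvg _ _ (nbhs x)).
  by apply: filterS (open_near oU Ux) => y; exact: fg.
have nfg x : U x -> {near x, f =1 g}.
  by move=> Ux; apply: filterS (open_near oU Ux) => y; exact: fg.
apply: Ck_intro.
- by move=> x; exact: Ck_cont (IH f g fg (Ck_pred Cf)).
- move=> i x Ux; apply: near_eq_derivable (nfg x Ux) _; exact: Ck_derivable Cf Ux.
- move=> i; apply: IH (Ck_partial i Cf) => x Ux.
  exact/near_eq_derive/nfg.
Qed.

Lemma Ck_cst N k (U : set 'rV[R]_N) (c : R) : Ck k U (cst c).
Proof.
elim: k c => [|k IH] c; first by split=> // x _; exact: cst_continuous.
apply: Ck_intro => [x _|i x _|i]; [exact: cst_continuous|exact: derivable_cst|].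
have -> : partial i (cst c) = cst 0 :> ('rV[R]_N -> R).
  by apply/funext => x; rewrite /partial derive_cst.
exact: IH.
Qed.

Lemma Ck_add N k (U : set 'rV[R]_N) f g : open U ->
  Ck k U f -> Ck k U g -> Ck k U (f + g).
Proof.
move=> oU; elim: k f g => [|k IH] f g Cf Cg.
  by split=> // x Ux; apply: continuousD; [exact: Ck_cont Cf Ux|exact: Ck_cont Cg Ux].
apply: Ck_intro => [x Ux|i x Ux|i].
- by apply: continuousD; [exact: Ck_cont Cf Ux|exact: Ck_cont Cg Ux].
- by apply: derivableD; [exact: Ck_derivable Cf Ux|exact: Ck_derivable Cg Ux].
- apply: Ck_eq (IH _ _ (Ck_partial i Cf) (Ck_partial i Cg)) => //.
  move=> x Ux; rewrite /partial deriveD //.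
    exact: Ck_derivable Cf Ux.
  exact: Ck_derivable Cg Ux.
Qed.

Lemma Ck_mul N k (U : set 'rV[R]_N) f g : open U ->
  Ck k U f -> Ck k U g -> Ck k U (f * g).
Proof.
move=> oU; elim: k f g => [|k IH] f g Cf Cg.
  by split=> // x Ux; apply: continuousM; [exact: Ck_cont Cf Ux|exact: Ck_cont Cg Ux].
apply: Ck_intro => [x Ux|i x Ux|i].
- by apply: continuousM; [exact: Ck_cont Cf Ux|exact: Ck_cont Cg Ux].
- by apply: derivableM; [exact: Ck_derivable Cf Ux|exact: Ck_derivable Cg Ux].
- apply: (@Ck_eq _ _ _ (f * partial i g + g * partial i f)) => //.
    move=> x Ux; rewrite /partial deriveM //.
      exact: Ck_derivable Cf Ux.
    exact: Ck_derivable Cg Ux.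
  by apply: Ck_add => //; apply: IH; (exact: Ck_pred || exact: Ck_partial).
Qed.

Lemma Ck_sum N k (U : set 'rV[R]_N) (I : Type) (r : seq I) (P : pred I)
    (f : I -> 'rV[R]_N -> R) : open U ->
  (forall i, P i -> Ck k U (f i)) -> Ck k U (\sum_(i <- r | P i) f i).
Proof.
move=> oU Cf; elim/big_ind : _ => //; first exact: (Ck_cst _ _ 0).
by move=> ? ?; exact: Ck_add.
Qed.

(** The inverse occurs in its own derivative -f' (1/f)^2, hence the induction
    on k. *)
Lemma Ck_inv N k (U : set 'rV[R]_N) f : open U -> (forall x, U x -> f x != 0) ->
  Ck k U f -> Ck k U (fun x => (f x)^-1).
Proof.
move=> oU f0; elim: k => [|k IH] Cf.
  by split=> // x Ux; apply: continuousV; [exact: f0|exact: Ck_cont Cf Ux].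
have Civ := IH (Ck_pred Cf).
apply: Ck_intro => [x Ux|i x Ux|i].
- by apply: continuousV; [exact: f0|exact: Ck_cont Cf Ux].
- by apply: derivableV; [exact: f0|exact: Ck_derivable Cf Ux].
- apply: (@Ck_eq _ _ _ (cst (-1) *
    ((fun x => (f x)^-1) * (fun x => (f x)^-1) * partial i f))) => //.
    move=> x Ux; rewrite /partial deriveV //; last 2 first.
      exact: f0.
      exact: Ck_derivable Cf Ux.
    rewrite expr2 invfM -[LHS]/(-1 * ((f x)^-1 * (f x)^-1 * _)) mulN1r -mulNr.
    by [].
  apply: Ck_mul => //; first exact: Ck_cst.
  by apply: Ck_mul => //; [exact: Ck_mul|exact: Ck_partial].
Qed.

Lemma is_derive_coord N (l i : 'I_N) (x : 'rV[R]_N) :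
  is_derive x (delta_mx 0 i) (fun z : 'rV[R]_N => z 0 l) (l == i)%:R.
Proof.
have E : (fun h : R => h^-1 *: (((fun z : 'rV[R]_N => z 0 l) \o shift x)
     (h *: delta_mx 0 i) - x 0 l)) @ 0^' --> ((l == i)%:R : R).
  apply: cvg_near_cst; near=> h.
  rewrite /= !mxE eqxx /= addrK -[LHS]/(_ * _) mulrA mulVf ?mul1r //.
  by near: h; exact: nbhs_dnbhs_neq.
split; first by apply/cvg_ex; eexists; exact: E.
exact: cvg_lim E.
Unshelve. all: by end_near. Qed.

Lemma Ck_coord N k (U : set 'rV[R]_N) l : Ck k U (fun z => z 0 l).
Proof.
case: k => [|k]; first by split=> // x _; exact: coord_continuous.
apply: Ck_intro => [x _|i x _|i]; first exact: coord_continuous.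
  by have [] := is_derive_coord l i x.
have -> : partial i (fun z => z 0 l) = cst (l == i)%:R :> ('rV[R]_N -> R).
  by apply/funext => x; have [] := is_derive_coord l i x.
exact: Ck_cst.
Qed.

Lemma is_derive_comp_coord N (g : R -> R) (l i : 'I_N) (x : 'rV[R]_N) :
  derivable g (x 0 l) 1 ->
  is_derive x (delta_mx 0 i) (fun z : 'rV[R]_N => g (z 0 l))
    (derive1 g (x 0 l) * (l == i)%:R).
Proof.
move=> dg.
have E : (fun h : R => h^-1 *: (((fun z : 'rV[R]_N => g (z 0 l)) \o shift x)
    (h *: delta_mx 0 i) - g (x 0 l))) =
  (fun h : R => h^-1 *: ((g \o shift (x 0 l)) (h *: (l == i)%:R) - g (x 0 l))).
  by apply/funext => h /=; rewrite !mxE eqxx.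
suff [d1 d2] : is_derive (x 0 l) ((l == i)%:R : R) g (derive1 g (x 0 l) * (l == i)%:R).
  by split; [rewrite /derivable E|rewrite /derive E].
case: (l == i); last by rewrite mulr0; exact: is_derive0.
by rewrite mulr1 derive1E; exact/derivableP.
Qed.

Lemma Ck_comp_coord N k (U : set 'rV[R]_N) l (g : R -> R) : open U ->
  smooth1 g -> Ck k U (fun z => g (z 0 l)).
Proof.
move=> oU sg.
suff H : forall j, Ck k U (fun z => derive1n j g (z 0 l)) by exact: (H 0).
have D j i x : is_derive x (delta_mx 0 i)
    (fun z : 'rV[R]_N => derive1n j g (z 0 l)) (derive1n j.+1 g (x 0 l) * (l == i)%:R)
  := @is_derive_comp_coord N _ l i x (sg j (x 0 l)).
elim: k => [|k IH] j.
  split=> // x Ux.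
  apply: (@continuous_comp _ _ _ (fun M : 'rV[R]_N => M 0 l) (derive1n j g)).
    exact: coord_continuous.
  exact/differentiable_continuous/derivable1_diffP/sg.
apply: Ck_intro => [x Ux|i x _|i].
- exact: (Ck_cont (IH j) Ux).
- by have [] := D j i x.
- apply: (@Ck_eq _ _ _ ((fun z => derive1n j.+1 g (z 0 l)) * cst (l == i)%:R)) => //.
  by move=> x _; have [] := D j i x.
by apply: Ck_mul => //; exact: Ck_cst.
Qed.
End ClassCk.

(** * Chain rule *)

Section Chain.
Context {R : realType}.

Lemma continuous_ltP N (f : 'rV[R]_N -> R) (z : 'rV[R]_N) :
  {for z, continuous f} <->
  forall e, 0 < e -> \forall x \near z, `|f z - f x| < e.
Proof.
have [H1 H2] := @cvgrPdist_lt _ _ _ (nbhs z) (nbhs_filter z) f (f z).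
by split.
Qed.

(** Telescope f(x) - f(z) along the path that moves the coordinates of z to those
    of x one at a time; a_l is the l-th difference quotient, which the mean value
    theorem expresses as a partial derivative of f at a point as close to z as x
    is. *)
Lemma caratheodory N (U : set 'rV[R]_N) (f : 'rV[R]_N -> R) (z : 'rV[R]_N) :
  open U -> U z -> Ck 1 U f ->
  exists a : 'I_N -> 'rV[R]_N -> R,
    [/\ forall l, a l z = partial l f z, forall l, {for z, continuous (a l)}
      & forall x, f x - f z = \sum_l (x 0 l - z 0 l) * a l x].
Proof.
move=> oU Uz Cf.
pose mix (j : nat) (x : 'rV[R]_N) : 'rV[R]_N :=
  \row_i if (i < j)%N then x 0 i else z 0 i.
have mixS (l : 'I_N) (x : 'rV[R]_N) :
    mix l.+1 x = mix l x + (x 0 l - z 0 l) *: delta_mx 0 l.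
  apply/rowP => i; rewrite !mxE eqxx ltnS leq_eqVlt -val_eqE /=.
  case: eqP => [/val_inj ->|_] /=; first by rewrite ltnn mulr1 addrC subrK.
  by rewrite mulr0 addr0.
(* Where x_l = z_l the difference quotient is replaced by the partial derivative, to
   make a_l continuous at z. *)
pose a (l : 'I_N) (x : 'rV[R]_N) : R := if x 0 l == z 0 l then partial l f z else
  (f (mix l.+1 x) - f (mix l x)) / (x 0 l - z 0 l).
exists a; split=> [l|l|x]; first by rewrite /a eqxx.
- have az : a l z = partial l f z by rewrite /a eqxx.
  apply/continuous_ltP => e e0.
  have : \forall y \near z, U y /\ `|partial l f z - partial l f y| < e.
    apply: filterI; first exact: (open_near oU).
    by have /continuous_ltP/(_ _ e0) := Ck_cont (Ck_partial l Cf) Uz.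
  move=> /nbhs_ballP[r /= r0 rU]; near=> x.
  rewrite az {1}/a; case: ifPn => [_|xz]; first by rewrite subrr normr0.
  have xr : ball z r x by near: x; exact: nbhsx_ballx.
  have inball (u : R) : 0 <= u <= 1 ->
      ball z r (mix l x + (u * (x 0 l - z 0 l)) *: delta_mx 0 l).
    move=> /andP[u0 u1]; split=> // i j; rewrite ord1 !mxE eqxx /=.
    have [_ /(_ 0 j)] := xr; rewrite /ball /= => xrj.
    case: eqP => [->|_]; last first.
      by rewrite mulr0 addr0; case: ifP => // _; rewrite subrr normr0.
    have [_ /(_ 0 l)] := xr; rewrite /ball /= => xrl.
    rewrite ltnn mulr1 opprD addrA subrr sub0r normrN normrM (ger0_norm u0).
    rewrite distrC in xrl; apply: le_lt_trans xrl.
    by rewrite ler_piMl.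
  have [u u01|u u01] := @partial_mvt _ _ f (mix l x) l (x 0 l - z 0 l).
    exact: Ck_derivable Cf (rU _ (inball u u01)).1.
  rewrite -mixS => ->; rewrite mulfK ?subr_eq0 //.
  by have [] := rU _ (inball u u01).
- have mixN : mix N x = x by apply/rowP => i; rewrite mxE ltn_ord.
  have mix0 : mix 0%N x = z by apply/rowP => i; rewrite mxE.
  rewrite -{1}mixN -mix0 -(telescope_sumr (fun j => f (mix j x)) (leq0n N)) mix0.
  rewrite big_mkord; apply: eq_bigr => l _; rewrite /a.
  case: eqP => [E|/eqP xz]; last by rewrite mulrC divfK // subr_eq0.
  by rewrite mixS E subrr scale0r addr0 subrr mul0r.
Unshelve. all: by end_near. Qed.

Lemma cvg_sumR (T : Type) (F : set_system T) (FF : Filter F) (I : Type)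
    (r : seq I) (f : I -> T -> R) (l : I -> R) :
  (forall i, f i x @[x --> F] --> l i) ->
  \sum_(i <- r) f i x @[x --> F] --> \sum_(i <- r) l i.
Proof.
move=> fl; elim: r => [|i r IH].
  by under eq_fun do rewrite big_nil; rewrite big_nil; exact: cvg_cst.
under eq_fun do rewrite big_cons; rewrite big_cons.
by apply: cvgD; [exact: fl|exact: IH].
Qed.

Lemma cvg_line N (z v : 'rV[R]_N) : (fun h : R => h *: v + z) @ 0^' --> z.
Proof.
apply: cvg_within_filter.
have : {for (0 : R), continuous (fun h : R => h *: v + z)}.
  by apply: continuousD; [exact: scalel_continuous|exact: cst_continuous].
by rewrite /prop_for /continuous_at scale0r add0r.
Qed.

(** Caratheodory's form of f at phi z turns the difference quotient of f \o phi into
    a sum of products of convergent factors. *)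
Lemma is_derive_comp M N (V : set 'rV[R]_N) (f : 'rV[R]_N -> R)
    (phi : 'rV[R]_M -> 'rV[R]_N) (z v : 'rV[R]_M) :
  open V -> V (phi z) -> Ck 1 V f -> {for z, continuous phi} ->
  (forall l, derivable (fun x => phi x 0 l) z v) ->
  is_derive z v (f \o phi)
    (\sum_l 'D_v (fun x => phi x 0 l) z * partial l f (phi z)).
Proof.
move=> oV Vz Cf cphi dphi.
have [a [az ca fE]] := caratheodory oV Vz Cf.
suff E : (fun h : R => h^-1 *: ((f \o phi \o shift z) (h *: v) - (f \o phi) z)) @ 0^'
    --> \sum_l 'D_v (fun x => phi x 0 l) z * partial l f (phi z).
  by split; [apply/cvg_ex; eexists; exact: E|exact: cvg_lim E].
rewrite (_ : (fun h : R => _) = (fun h : R => \sum_l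
   (h^-1 *: (phi (h *: v + z) 0 l - phi z 0 l)) * a l (phi (h *: v + z)))); last first.
  apply/funext => h /=; rewrite fE scaler_sumr; apply: eq_bigr => l _.
  by rewrite scalerAl.
apply: cvg_sumR => l; apply: cvgM; first exact: dphi.
rewrite -az; apply: (@cvg_comp _ _ _ (fun h : R => phi (h *: v + z)) (a l) _ (nbhs (phi z))).
  apply: (@cvg_comp _ _ _ (fun h : R => h *: v + z) phi _ (nbhs z)) => //.
  exact: cvg_line.
exact: ca.
Qed.

Lemma Ck_comp M N k (U : set 'rV[R]_M) (V : set 'rV[R]_N) (f : 'rV[R]_N -> R)
    (phi : 'rV[R]_M -> 'rV[R]_N) :
  open U -> open V -> (forall x, U x -> V (phi x)) ->
  Ck k V f -> (forall l, Ck k U (fun x => phi x 0 l)) -> Ck k U (f \o phi).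
Proof.
move=> oU oV UV; elim: k f => [|k IH] f Cf Cphi.
  split=> // x Ux; apply: continuous_comp.
    by apply: continuous_rV => l; exact: Ck_cont (Cphi l) Ux.
  exact: Ck_cont Cf (UV _ Ux).
have Cf1 : Ck 1 V f.
  by elim: (k) Cf => // j jH /Ck_pred.
have D i x : U x -> is_derive x (delta_mx 0 i) (f \o phi)
    (\sum_l partial i (fun x => phi x 0 l) x * partial l f (phi x)).
  move=> Ux; apply: (is_derive_comp oV (UV _ Ux) Cf1).
    by apply: continuous_rV => l; exact: Ck_cont (Cphi l) Ux.
  by move=> l; exact: Ck_derivable (Cphi l) Ux.
apply: Ck_intro => [x Ux|i x Ux|i].
- apply: continuous_comp.
    by apply: continuous_rV => l; exact: Ck_cont (Cphi l) Ux.
  exact: Ck_cont Cf (UV _ Ux).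
- by have [] := D i x Ux.
- apply: (@Ck_eq _ _ _ _ (\sum_l partial i (fun x => phi x 0 l) * (partial l f \o phi))) => //.
    move=> x Ux; have [_ E] := D i x Ux; rewrite [RHS]E fct_sumE.
    by apply: eq_bigr.
  apply: Ck_sum => // l _; apply: Ck_mul => //; first exact: Ck_partial (Cphi l).
  by apply: IH (Ck_partial l Cf) _ => j; exact: Ck_pred (Cphi j).
Qed.

(** Caratheodory's form shows that f(z + h) - f(z) = o(h), as each a_l tends to 0
    at z. The constant e / (N + 1) shares e among the N terms, N = 0 included. *)
Lemma critical_point_partial0 N (U : set 'rV[R]_N) (f : 'rV[R]_N -> R) (z : 'rV[R]_N) :
  open U -> U z -> Ck 1 U f -> (forall l, partial l f z = 0) ->
  critical_point f z.
Proof.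
move=> oU Uz Cf p0 v.
have [a [az ca fE]] := caratheodory oU Uz Cf.
have [L L0] : exists L : {linear 'rV[R]_N -> R}, L = (fun=> 0) :> ('rV[R]_N -> R).
  by exists \0.
rewrite (@diff_unique _ _ _ f L z) ?L0 //; first by move=> ?; exact: cst_continuous.
apply/eqaddoP => e e0.
have d0 : 0 < e / N.+1%:R by rewrite divr_gt0.
have near_a l : \forall x \near z, `|a l x| < e / N.+1%:R.
  have /continuous_ltP/(_ _ d0) := ca l.
  by apply: filterS => x; rewrite az p0 sub0r normrN.
have : \forall x \near z, forall l, `|a l x| < e / N.+1%:R.
  exact: (filter_forall (nbhs_filter z)) near_a.
rewrite (near_shift 0) /=; apply: filterS => h ah.
rewrite -[X in `|X|]/(f (h + z) - (f z + 0)) addr0 fE.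
rewrite subr0 in ah.
apply: le_trans (ler_norm_sum _ _ _) _.
apply: (@le_trans _ _ (\sum_(l < N) `|h| * (e / N.+1%:R))).
  apply: ler_sum => l _; rewrite normrM ler_pM //; last exact: ltW.
  rewrite !mxE addrK [leRHS]/Num.norm /= mx_normrE.
  exact: (le_bigmax _ (fun i => `|h i.1 i.2|) (0, l)).
rewrite sumr_const card_ord -[leLHS]mulr_natr -mulrA mulrC ler_wpM2r //.
by rewrite mulrAC ler_pdivrMr // ler_pM2l // ler_nat.
Qed.
End Chain.

(** * Solving an equation for one coordinate *)

Section SetCoord.
Context {R : realType} {N : nat}.
Implicit Types (k : 'I_N) (z w : 'rV[R]_N).

Definition set_coord k (c : R) z : 'rV[R]_N := \row_j if j == k then c else z 0 j.

Lemma set_coord_same k c z : set_coord k c z 0 k = c.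
Proof. by rewrite mxE eqxx. Qed.

Lemma set_coord_other k c z j : j != k -> set_coord k c z 0 j = z 0 j.
Proof. by rewrite mxE => /negbTE ->. Qed.

Lemma set_coord_set_coord k c d z : set_coord k c (set_coord k d z) = set_coord k c z.
Proof. by apply/rowP => j; rewrite !mxE; case: eqP. Qed.

Lemma set_coord_id k z : set_coord k (z 0 k) z = z.
Proof. by apply/rowP => j; rewrite !mxE; case: eqP => [->|]. Qed.

Lemma set_coord_add k (c b : R) z : set_coord k c z + b *: delta_mx 0 k = set_coord k (c + b) z.
Proof.
by apply/rowP => j; rewrite !mxE eqxx /=; case: eqP; rewrite ?mulr1 ?mulr0 ?addr0.
Qed.

Lemma set_coordE (T : Type) (g : T -> R) (phi : T -> 'rV[R]_N) k l :
  (fun x => set_coord k (g x) (phi x) 0 l) = if l == k then g else fun x => phi x 0 l.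
Proof. by apply/funext => x; rewrite mxE; case: ifP. Qed.

Lemma set_coord_continuous k (c : R) : continuous (set_coord k c).
Proof.
move=> z; apply: continuous_rV => l; rewrite (set_coordE (cst c) id).
by case: (l == k); [exact: cst_continuous|exact: coord_continuous].
Qed.

Lemma set_coord_continuous_val k z : continuous (fun c => set_coord k c z).
Proof.
move=> c; apply: continuous_rV => l; rewrite (set_coordE id (cst z)).
by case: (l == k); [exact: (@cvg_id _ (nbhs c))|exact: cst_continuous].
Qed.

(** Balls of the sup norm are boxes, hence convex along each coordinate. *)
Lemma ball_set_coord p (r : R) k (s t s' : R) w : s <= t -> t <= s' ->
  ball p r (set_coord k s w) -> ball p r (set_coord k s' w) -> ball p r (set_coord k t w).
Proof.
move=> st ts' [r0 b1] [_ b2]; split=> // i j; rewrite ord1.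
have := b1 0 j; have := b2 0 j; rewrite /ball /= !mxE; case: ifP => // _.
rewrite !ltr_norml; lra.
Qed.

Lemma Ck_set_coord k (U : set 'rV[R]_N) f n l : (forall j, Ck j U f) ->
  Ck n U (fun z => set_coord k (f z) z 0 l).
Proof.
move=> Cf; rewrite (set_coordE f id).
by case: (l == k); [exact: Cf|exact: Ck_coord].
Qed.
End SetCoord.

(** In this section f is smooth and strictly increasing in the k-th coordinate on a
    box B around p. The map z |-> (z with z_k replaced by f(z)) is then injective
    on B; its image is [box_image] and its inverse is [box_inv], which replaces w_k
    by the solution [implicit w] of f = w_k on the line through w parallel to the
    k-th axis. *)
Section Straighten.
Context {R : realType} {N : nat}.
Variables (k : 'I_N) (p : 'rV[R]_N) (r : R) (f : 'rV[R]_N -> R).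
Local Notation B := (ball p r).
Hypothesis r0 : 0 < r.
Hypothesis Cf : forall j, Ck j B f.
Hypothesis dpos : forall x, B x -> 0 < partial k f x.

Let oB : open B.
Proof. exact: ball_open. Qed.

Lemma box_incr w (s s' : R) : s < s' -> B (set_coord k s w) -> B (set_coord k s' w) ->
  f (set_coord k s w) < f (set_coord k s' w).
Proof.
move=> ss' Bs Bs'.
have inB (u : R) : 0 <= u <= 1 -> B (set_coord k (s + u * (s' - s)) w).
  by move=> /andP[u0 u1]; apply: ball_set_coord Bs Bs'; nra.
have [u u01|u u01] := @partial_mvt _ _ f (set_coord k s w) k (s' - s).
  by rewrite set_coord_add; exact: Ck_derivable (Cf 1) (inB u u01).
rewrite !set_coord_add (addrC s) subrK => E.
by rewrite -subr_gt0 E mulr_gt0 ?subr_gt0 //; apply: dpos; exact: inB.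
Qed.

Definition solves w s := B (set_coord k s w) /\ f (set_coord k s w) = w 0 k.

Lemma solves_inj w s s' : solves w s -> solves w s' -> s = s'.
Proof.
move=> [Bs fs] [Bs' fs']; case: (ltgtP s s') => // ss'.
  by have := box_incr ss' Bs Bs'; rewrite fs fs' ltxx.
by have := box_incr ss' Bs' Bs; rewrite fs fs' ltxx.
Qed.

(** Openness of the image and continuity of the inverse at once: at s0 - c and
    s0 + c the function f lies strictly on opposite sides of w_k, which persists
    for w close to w0, and the intermediate value theorem applies in between. *)
Lemma solves_near w0 s0 (e : R) : 0 < e -> solves w0 s0 ->
  \forall w \near w0, exists2 s, `|s0 - s| < e & solves w s.
Proof.
move=> e0 [Bs0 fs0].
have [d /= d0 dB] : exists2 d : R, 0 < d & forall s, `|s0 - s| < d -> B (set_coord k s w0).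
  have : \forall s \near s0, B (set_coord k s w0).
    have := @set_coord_continuous_val _ _ k w0 s0; apply.
    exact: (open_near oB).
  by move=> /nbhs_ballP[d d0 dB]; exists d => // s; exact: dB.
pose c := Num.min d e / 2.
have c0 : 0 < c by rewrite /c divr_gt0 // lt_min d0 e0.
have /andP[cd ce] : (c < d) && (c < e).
  rewrite -lt_min /c ltr_pdivrMr // ltr_pMr ?lt_min ?d0 //; lra.
have B1 : B (set_coord k (s0 - c) w0).
  by apply: dB; rewrite opprB addrC subrK gtr0_norm.
have B2 : B (set_coord k (s0 + c) w0).
  by apply: dB; rewrite opprD addrA subrr sub0r normrN gtr0_norm.
have f1 : f (set_coord k (s0 - c) w0) < w0 0 k.
  by rewrite -fs0; apply: box_incr => //; rewrite ltrBlDr ltrDl.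
have f2 : w0 0 k < f (set_coord k (s0 + c) w0).
  by rewrite -fs0; apply: box_incr => //; rewrite ltrDl.
have cts s : B (set_coord k s w0) ->
    (f (set_coord k s w) - w 0 k) @[w --> w0] --> f (set_coord k s w0) - w0 0 k.
  move=> Bs; apply: continuousB; last exact: coord_continuous.
  apply: continuous_comp; first exact: set_coord_continuous.
  exact: Ck_cont (Cf 0) Bs.
have nB s : B (set_coord k s w0) -> \forall w \near w0, B (set_coord k s w).
  move=> Bs; apply: (@set_coord_continuous _ _ k s w0); exact: (open_near oB).
have n1 : \forall w \near w0, f (set_coord k (s0 - c) w) - w 0 k < 0.
  have := cts _ B1 [set x : R | x < 0]; apply.
  apply: (open_near (U:=[set x : R | x < 0])); [exact: open_lt|by rewrite /= subr_lt0].
have n2 : \forall w \near w0, 0 < f (set_coord k (s0 + c) w) - w 0 k.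
  have := cts _ B2 [set x : R | 0 < x]; apply.
  apply: (open_near (U:=[set x : R | 0 < x])); [exact: open_gt|by rewrite /= subr_gt0].
near=> w.
have Bw1 : B (set_coord k (s0 - c) w) by near: w; exact: nB.
have Bw2 : B (set_coord k (s0 + c) w) by near: w; exact: nB.
have fw1 : f (set_coord k (s0 - c) w) - w 0 k < 0 by near: w.
have fw2 : 0 < f (set_coord k (s0 + c) w) - w 0 k by near: w.
have inB t : t \in `[s0 - c, s0 + c] -> B (set_coord k t w).
  by rewrite in_itv /= => /andP[? ?]; apply: ball_set_coord Bw1 Bw2.
have [|||t tI ft] := @IVT _ (fun t => f (set_coord k t w)) (s0 - c) (s0 + c) (w 0 k).
- by rewrite lerD2l ge0_cp // ltW.
- apply: continuous_in_subspaceT => t /[1!inE] tI.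
  apply: (@continuous_comp _ _ _ (fun t => set_coord k t w) f).
    exact: set_coord_continuous_val.
  exact: Ck_cont (Cf 0) (inB _ tI).
- by rewrite ge_min le_max; apply/andP; split; apply/orP; [left|right]; lra.
exists t; last by split; [exact: inB|].
apply: le_lt_trans ce; rewrite in_itv /= in tI; rewrite ler_norml; lra.
Unshelve. all: by end_near. Qed.

Definition box_image : set 'rV[R]_N := [set w | exists s, solves w s].
Definition implicit w : R := xget 0 (solves w).
Definition box_inv w := set_coord k (implicit w) w.

Lemma implicitP w : box_image w -> solves w (implicit w).
Proof. by case=> s sol; exact: (@xgetPex _ 0 (solves w) (ex_intro _ s sol)). Qed.

Lemma implicit_uniq w s : solves w s -> implicit w = s.
Proof. by move=> sol; apply: (solves_inj _ sol); apply: implicitP; exists s. Qed.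

Lemma box_image_open : open box_image.
Proof.
rewrite openE => w [s sol].
by apply: filterS (solves_near ltr01 sol) => v [t _ tsol]; exists t.
Qed.

Lemma implicit_continuous w : box_image w -> {for w, continuous implicit}.
Proof.
move=> Vw; apply/continuous_ltP => e e0.
apply: filterS (solves_near e0 (implicitP Vw)) => v [t te tsol].
by rewrite (implicit_uniq tsol).
Qed.

Lemma box_inv_continuous w : box_image w -> {for w, continuous box_inv}.
Proof.
move=> Vw; apply: continuous_rV => l; rewrite /box_inv (set_coordE implicit id).
by case: (l == k); [exact: implicit_continuous|exact: coord_continuous].
Qed.

(** The value that implicit differentiation of f(w with w_k := implicit w) = w_k
    along the i-th axis gives for the derivative of [implicit]. *)
Definition implicit_slope i w :=
  ((k == i)%:R + \sum_l - ((l != k) && (l == i))%:R * partial l f (box_inv w)) *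
  (partial k f (box_inv w))^-1.

(** Write the equation f (box_inv w) = w_k at w and at w + t e_i, subtract, and
    use Caratheodory's form of f at box_inv w: the increment of [implicit] appears
    linearly, with a coefficient that tends to the k-th partial derivative. *)
Lemma is_derive_implicit i w : box_image w ->
  is_derive w (delta_mx 0 i) implicit (implicit_slope i w).
Proof.
move=> Vw; have [Bw fw] := implicitP Vw.
have [a [az ca fE]] := caratheodory oB Bw (Cf 1).
pose x (t : R) := box_inv (t *: delta_mx 0 i + w).
have cx l : a l (x t) @[t --> 0^'] --> partial l f (box_inv w).
  rewrite -az; apply: (@cvg_comp _ _ _ x (a l) _ (nbhs (box_inv w))); last exact: ca.
  apply: (@cvg_comp _ _ _ (fun h : R => h *: delta_mx 0 i + w) box_inv _ (nbhs w)).
    exact: cvg_line.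
  exact: box_inv_continuous.
have dk : partial k f (box_inv w) != 0 by rewrite gt_eqF // dpos.
suff E : (fun t : R => t^-1 *: ((implicit \o shift w) (t *: delta_mx 0 i) - implicit w))
    @ 0^' --> implicit_slope i w.
  by split; [apply/cvg_ex; eexists; exact: E|exact: cvg_lim E].
have L : ((k == i)%:R + \sum_l - ((l != k) && (l == i))%:R * a l (x t)) *
    (a k (x t))^-1 @[t --> 0^'] --> implicit_slope i w.
  apply: cvgM; last by apply: cvgV => //; exact: cx.
  apply: cvgD; first exact: cvg_cst.
  by apply: cvg_sumR => l; apply: cvgM; [exact: cvg_cst|exact: cx].
apply: cvg_trans L; apply: near_eq_cvg; near=> t.
have t0 : t != 0 by near: t; exact: nbhs_dnbhs_neq.
have Vt : box_image (t *: delta_mx 0 i + w).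
  near: t; have := @cvg_line _ _ w (delta_mx 0 i) box_image; apply.
  by apply: (open_near box_image_open).
have at0 : a k (x t) != 0.
  near: t; have := cx k [set x : R | x != 0]; apply.
  exact: (open_near (U := [set x : R | x != 0]) (@open_neq R 0) dk).
have [_ ft] := implicitP Vt.
have := fE (x t); rewrite /x /box_inv ft fw -/(box_inv _) -/(x t).
set dh := implicit _ - _.
have -> : \sum_l (x t 0 l - set_coord k (implicit w) w 0 l) * a l (x t) =
   t * (\sum_l ((l != k) && (l == i))%:R * a l (x t)) + dh * a k (x t).
  rewrite mulr_sumr [in RHS](bigD1 k) //= eqxx mul0r mulr0 add0r.
  rewrite [in LHS](bigD1 k) //= /x !set_coord_same addrC; congr (_ + _).
  apply: eq_bigr => l lk; rewrite lk /= !set_coord_other // !mxE eqxx /= addrK.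
  by rewrite mulrA.
rewrite !mxE eqxx /= addrK => E.
apply: (mulIf at0); rewrite divfK //.
rewrite -[RHS]/(t^-1 * dh * _) -mulrA.
have -> : dh * a k (x t) = t * ((k == i)%:R + \sum_l - ((l != k) && (l == i))%:R * a l (x t)).
  under [in RHS]eq_bigr do rewrite mulNr.
  by rewrite sumrN mulrDr mulrN E addrAC subrr add0r.
by rewrite mulrA mulVf // mul1r.
Unshelve. all: by end_near. Qed.

(** If [implicit] is of class C^j, so is [box_inv], hence so is [implicit_slope]:
    one order of regularity is gained at each step. *)
Lemma Ck_implicit j : Ck j box_image implicit.
Proof.
have oV := box_image_open.
elim: j => [|j IH]; first by split=> // w; exact: implicit_continuous.
have Cinv l : Ck j box_image (fun w => box_inv w 0 l).
  rewrite /box_inv (set_coordE implicit id).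
  by case: (l == k) => //; exact: Ck_coord.
have Cd l : Ck j box_image (partial l f \o box_inv).
  apply: (Ck_comp oV oB _ (Ck_partial l (Cf j.+1)) Cinv) => w Vw.
  by have [] := implicitP Vw.
apply: Ck_intro => [w|i w Vw|i]; first exact: implicit_continuous.
  by have [] := is_derive_implicit i Vw.
apply: (@Ck_eq _ _ _ _ ((cst (k == i)%:R +
   \sum_l cst (- ((l != k) && (l == i))%:R) * (partial l f \o box_inv)) *
   (fun w => ((partial k f \o box_inv) w)^-1))) => //.
  move=> w Vw; have [_ E] := is_derive_implicit i Vw.
  rewrite [RHS]E /implicit_slope; congr ((_ + _) * _).
  by rewrite fct_sumE.
apply: Ck_mul => //.
  apply: Ck_add => //; first exact: Ck_cst.
  by apply: Ck_sum => // l _; apply: Ck_mul => //; exact: Ck_cst.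
apply: Ck_inv => // w Vw; have [Bw _] := implicitP Vw.
by rewrite gt_eqF // dpos.
Qed.
End Straighten.

(** * Charts and submanifolds *)

Section Charts.
Context {R : realType}.

Lemma row_coordE (T : Type) N (g : 'I_N -> T -> R) (j : 'I_1) l :
  (fun x => (\row_i g i x) j l) = g l.
Proof. by apply/funext => x; rewrite mxE. Qed.

Lemma smooth_on_rV M N (U : set 'rV[R]_M) (phi : 'rV[R]_M -> 'rV[R]_N) :
  open U -> (forall k l, Ck k U (fun x => phi x 0 l)) -> smooth_on U phi.
Proof.
move=> oU Cphi.
have D s l x : U x -> {for x, continuous (iter_partial s (fun y => phi y 0 l))} /\
    forall i, derivable (iter_partial s (fun y => phi y 0 l)) x (delta_mx 0 i).
  by move=> Ux; apply: ((smooth_onP U _).2 (fun k => Cphi k l)).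
have E s x : U x ->
    iter_partial s phi x = \row_l iter_partial s (fun y => phi y 0 l) x.
  elim: s x => [|i s IH] x Ux; first by apply/rowP => l; rewrite mxE.
  have nE : \near x, iter_partial s phi x =
      \row_l iter_partial s (fun y => phi y 0 l) x.
    by apply: filterS (open_near oU Ux) => y; exact: IH.
  rewrite /= {1}/partial (near_eq_derive _ nE) derive_mx.
    apply/rowP => l; rewrite !mxE.
    by rewrite row_coordE.
  apply/derivable_mxP => j l; rewrite row_coordE.
  by have [_] := D s l x Ux.
move=> s x Ux.
have nE : \near x, \row_l iter_partial s (fun y => phi y 0 l) x =
    iter_partial s phi x.
  by apply: filterS (open_near oU Ux) => y Uy; rewrite E.
split=> [|i].
  have c : {for x, continuous (fun x => \row_l iter_partial s (fun y => phi y 0 l) x)}.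
    apply: continuous_rV => l; rewrite row_coordE.
    by have [] := D s l x Ux.
  suff : iter_partial s phi y @[y --> x] --> iter_partial s phi x by [].
  rewrite E //; apply: cvg_trans c; exact: (@near_eq_cvg _ _ (nbhs x)).
apply: near_eq_derivable nE _; apply/derivable_mxP => j l; rewrite row_coordE.
by have [_] := D s l x Ux.
Qed.

(** Smoothness is required of each coordinate function, which spares the
    vector-valued derivatives of [diffeo_between]; [smooth_on_rV] supplies these
    in the end. *)
Definition smooth_inverses N (U V : set 'rV[R]_N) (phi psi : 'rV[R]_N -> 'rV[R]_N) :=
  [/\ (forall k l, Ck k U (fun x => phi x 0 l)),
      (forall k l, Ck k V (fun x => psi x 0 l)),
      (forall x, U x -> V (phi x) /\ psi (phi x) = x)
    & (forall y, V y -> U (psi y) /\ phi (psi y) = y)].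

Definition local_chart N (p : 'rV[R]_N) (phi : 'rV[R]_N -> 'rV[R]_N) : Prop :=
  exists U V psi, [/\ open U, U p, open V & smooth_inverses U V phi psi].

Lemma open_preimage_in M N (V : set 'rV[R]_M) (W : set 'rV[R]_N)
    (psi : 'rV[R]_M -> 'rV[R]_N) :
  open V -> (forall l, Ck 0 V (fun x => psi x 0 l)) -> open W ->
  open (V `&` psi @^-1` W).
Proof.
move=> oV Cpsi oW; rewrite openE => y [Vy Wy].
apply: filterI; first exact: (open_near oV Vy).
have c : {for y, continuous psi}.
  by apply: continuous_rV => l; exact: Ck_cont (Cpsi l) Vy.
have {}c : psi z @[z --> y] --> psi y by exact: c.
by have := c W; apply; exact: (open_near oW).
Qed.

Lemma local_chart_restrict N (p : 'rV[R]_N) phi (W : set 'rV[R]_N) :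
  local_chart p phi -> open W -> W p ->
  exists U V psi, [/\ open U, U p, open V, U `<=` W & smooth_inverses U V phi psi].
Proof.
move=> [U [V [psi [oU Up oV [Cphi Cpsi UV VU]]]]] oW Wp.
exists (U `&` W), (V `&` psi @^-1` W), psi; split=> //.
- exact: openI.
- exact: open_preimage_in.
- split.
  + by move=> k l; apply: Ck_sub (Cphi k l) => x [].
  + by move=> k l; apply: Ck_sub (Cpsi k l) => x [].
  + by move=> x [Ux Wx]; have [? E] := UV x Ux; do !split=> //; rewrite /= E.
  + by move=> y [Vy Wy]; have [? E] := VU y Vy.
Qed.

Lemma local_chart_comp N (p : 'rV[R]_N) phi1 phi2 :
  local_chart p phi1 -> local_chart (phi1 p) phi2 -> local_chart p (phi2 \o phi1).
Proof.
move=> [U1 [V1 [psi1 [oU1 U1p oV1 [Cphi1 Cpsi1 UV1 VU1]]]]] chart2.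
have [] := local_chart_restrict chart2 oV1; first by have [] := UV1 p U1p.
move=> U2 [V2 [psi2 [oU2 U2p oV2 U2V1 [Cphi2 Cpsi2 UV2 VU2]]]].
have oU : open (U1 `&` phi1 @^-1` U2) by exact: open_preimage_in.
exists (U1 `&` phi1 @^-1` U2), V2, (psi1 \o psi2); split=> //; split.
- move=> k l; apply: (Ck_comp oU oU2 _ (Cphi2 k l)) => [x []//|j].
  by apply: Ck_sub (Cphi1 k j) => x [].
- move=> k l; apply: (Ck_comp oV2 oV1 _ (Cpsi1 k l)) => [y Vy|j]; last exact: Cpsi2.
  by apply: U2V1; have [] := VU2 y Vy.
- move=> x [/= Ux U2x]; have [_ E1] := UV1 x Ux; have [V2x E2] := UV2 _ U2x.
  by split=> //; rewrite E2.
- move=> y Vy /=; have [Uy E2] := VU2 y Vy.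
  by have [U1y E1] := VU1 _ (U2V1 _ Uy); rewrite E1.
Qed.

Lemma local_chart_perm N (p : 'rV[R]_N) (s : 'S_N) : local_chart p (col_perm s).
Proof.
exists setT, setT, (col_perm (s^-1)%g); split=> //; try exact: openT; split=> //.
- by move=> k l; under eq_fun do rewrite mxE; exact: Ck_coord.
- by move=> k l; under eq_fun do rewrite mxE; exact: Ck_coord.
- by move=> x _; split=> //; rewrite -col_permM mulVg col_perm1.
- by move=> x _; split=> //; rewrite -col_permM mulgV col_perm1.
Qed.

(** A neighbourhood on which the partial derivative stays positive contains a box,
    on which the straightening map is inverted. *)
Lemma local_chart_set_coord N (U : set 'rV[R]_N) (f : 'rV[R]_N -> R) p k :
  open U -> U p -> (forall j, Ck j U f) -> 0 < partial k f p ->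
  local_chart p (fun z => set_coord k (f z) z).
Proof.
move=> oU Up Cf dp.
have : \near p, U p /\ 0 < partial k f p.
  apply: filterI; first exact: (open_near oU).
  have c : partial k f y @[y --> p] --> partial k f p.
    exact: Ck_cont (Ck_partial k (Cf 1%N)) Up.
  have := c [set x : R | 0 < x]; apply.
  exact: (open_near (U := [set x : R | 0 < x]) (@open_gt R 0) dp).
move=> /nbhs_ballP[r /= r0 rB].
have CB j : Ck j (ball p r) f by apply: Ck_sub (Cf j) => x /rB[].
have dB x : ball p r x -> 0 < partial k f x by move=> /rB[].
have oB : open (ball p r) by exact: ball_open.
exists (ball p r), (box_image k p r f), (box_inv k p r f); split=> //.
- exact: ballxx.
- exact: box_image_open.
- split.
  + by move=> j l; exact: Ck_set_coord.
  + move=> j l; rewrite /box_inv (set_coordE (implicit k p r f) id).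
    by case: (l == k); [exact: Ck_implicit|exact: Ck_coord].
  + move=> x Bx.
    have sol : solves k p r f (set_coord k (f x) x) (x 0 k).
      by split; rewrite set_coord_set_coord set_coord_id ?set_coord_same.
    split; first by exists (x 0 k).
    by rewrite /box_inv (implicit_uniq CB dB sol) set_coord_set_coord set_coord_id.
  + move=> y Vy; have [By fy] := implicitP Vy; split=> //.
    by rewrite /box_inv fy set_coord_set_coord set_coord_id.
Qed.

Lemma submanifold_of_charts N d (S : set 'rV[R]_N) : (d <= N)%N ->
  (forall p, S p -> exists2 phi, local_chart p phi &
     \forall z \near p, S z <-> (forall i : 'I_N, (d <= i)%N -> phi z 0 i = 0)) ->
  smooth_submanifold d S.
Proof.
move=> dN H; split=> // p Sp; have [phi chart nS] := H p Sp.
move: nS; rewrite -[X in X -> _]/(nbhs p _) nbhsE => -[W [oW Wp] WS].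
have [U [V [psi [oU Up oV UW [Cphi Cpsi UV VU]]]]] := local_chart_restrict chart oW Wp.
exists U, V, phi; split=> //.
- exists psi; split.
  + by split; exact: smooth_on_rV.
  + by split=> _ [x Ux <-]; [have [] := UV x Ux|have [] := VU x Ux].
  + by move=> x /set_mem /UV[].
  + by move=> y /set_mem /VU[].
- apply/seteqP; split=> [_ [x [Ux Sx] <-]|y [Vy y0]].
    split; first by have [] := UV x Ux.
    by apply/WS => //; exact: UW.
  have [Uy E] := VU y Vy; exists (psi y) => //; split=> //.
  by apply/(WS _ (UW _ Uy)); rewrite E.
Qed.

Lemma partial_set_coord N (f : 'rV[R]_N -> R) k1 k2 c z : k1 != k2 ->
  (forall c z, f (set_coord k1 c z) = f z) -> partial k2 f (set_coord k1 c z) = partial k2 f z.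
Proof.
move=> k12 fk; rewrite /partial /derive.
have E (h : R) : f (h *: delta_mx 0 k2 + set_coord k1 c z) = f (h *: delta_mx 0 k2 + z).
  rewrite -(fk c (h *: _ + z)); congr (f _).
  apply/rowP => j; rewrite !mxE eqxx /=; have [->|//] := eqVneq j k1.
  by rewrite (negbTE k12) mulr0 add0r.
suff -> : (fun h : R => h^-1 *: ((f \o shift (set_coord k1 c z)) (h *: delta_mx 0 k2)
     - f (set_coord k1 c z))) =
  (fun h : R => h^-1 *: ((f \o shift z) (h *: delta_mx 0 k2) - f z)) by [].
by apply/funext => h; rewrite /= E fk.
Qed.

Lemma partial_scale N (f : 'rV[R]_N -> R) (U : set 'rV[R]_N) k c z :
  U z -> Ck 1 U f -> partial k (cst c * f) z = c * partial k f z.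
Proof.
move=> Uz Cf; rewrite /partial deriveM; last 2 first.
- exact: derivable_cst.
- exact: Ck_derivable Cf Uz.
by rewrite derive_cst scaler0 addr0.
Qed.

(** The charts put the two distinguished coordinates in the last two positions, the
    ones that vanish on a slice of codimension 2. *)
Lemma exists_perm_last m (k1 k2 : 'I_(m + 2)) : k1 != k2 ->
  exists s : 'S_(m + 2), forall i : 'I_(m + 2), (m <= i)%N ->
    s i = if i == m :> nat then k1 else k2.
Proof.
move=> k12.
have am : (m < m + 2)%N by rewrite addn2 ltnS leqnSn.
have bm : (m.+1 < m + 2)%N by rewrite addn2.
pose a := Ordinal am; pose b := Ordinal bm.
have ab : a != b by rewrite -val_eqE /= neq_ltn ltnSn.
pose c := tperm a k1 k2.
have ca : a != c.
  by rewrite -(inj_eq (@perm_inj _ (tperm a k1))) /c tpermK tpermL.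
exists (tperm b c * tperm a k1)%g => i mi; rewrite permM.
have [im|im] := eqVneq (i : nat) m.
  have -> : i = a by exact: val_inj.
  by rewrite (tpermD (x := b) (y := c)) 1?eq_sym // tpermL.
have -> : i = b.
  apply: val_inj => /=; apply/eqP; rewrite eqn_leq ltn_neqAle eq_sym im mi andbT.
  by have := ltn_ord i; rewrite [X in (_ < X)%N -> _]addn2 ltnS andbT.
have bc : tperm b c b = c by exact: tpermL.
by rewrite bc /c tpermK.
Qed.

(** As f2 does not depend on the coordinate k1, replacing z_k1 by f1(z) leaves both
    f2 and its k2-th partial derivative unchanged. Hence the second straightening
    may follow the first one, and after both of them the coordinates k1 and k2 are
    f1 and f2, up to nonzero constants. *)
Lemma two_equations_submanifold m (S : set 'rV[R]_(m + 2)) :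
  (forall p, S p -> exists (f1 f2 : 'rV[R]_(m + 2) -> R) (k1 k2 : 'I_(m + 2))
     (U1 U2 : set 'rV[R]_(m + 2)), k1 != k2 /\
     [/\ [/\ open U1, U1 p, forall k, Ck k U1 f1 & partial k1 f1 p != 0],
         [/\ open U2, U2 p, forall k, Ck k U2 f2 & partial k2 f2 p != 0],
         forall c z, U2 z -> U2 (set_coord k1 c z),
         forall c z, f2 (set_coord k1 c z) = f2 z
       & \forall z \near p, S z <-> f1 z = 0 /\ f2 z = 0]) ->
  smooth_submanifold m S.
Proof.
move=> H; apply: submanifold_of_charts; first exact: leq_addr.
move=> p /H[f1 [f2 [k1 [k2 [U1 [U2 [k12]]]]]]].
move=> [[oU1 U1p Cf1 d1] [oU2 U2p Cf2 d2] U2_indep f2_indep nS].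
have [s sE] := exists_perm_last k12.
(* Multiplying f_i by its partial derivative at p makes the latter positive and
   leaves the zero set unchanged. *)
pose c1 := partial k1 f1 p; pose c2 := partial k2 f2 p.
pose g1 := cst c1 * f1; pose g2 := cst c2 * f2.
have Cg1 k : Ck k U1 g1 by apply: Ck_mul => //; exact: Ck_cst.
have Cg2 k : Ck k U2 g2 by apply: Ck_mul => //; exact: Ck_cst.
have g2_indep c z : g2 (set_coord k1 c z) = g2 z.
  by rewrite -[LHS]/(c2 * f2 _) f2_indep.
pose phi1 z := set_coord k1 (g1 z) z; pose phi2 z := set_coord k2 (g2 z) z.
exists (col_perm s \o (phi2 \o phi1)).
  apply: local_chart_comp; last exact: local_chart_perm.
  apply: local_chart_comp.
    apply: (local_chart_set_coord oU1 U1p Cg1).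
    by rewrite (partial_scale _ _ U1p (Cf1 1%N)) -expr2 exprn_even_gt0.
  apply: (local_chart_set_coord oU2 _ Cg2); first exact: U2_indep.
  rewrite partial_set_coord // (partial_scale _ _ U2p (Cf2 1%N)) -expr2.
  by rewrite exprn_even_gt0.
have phi_k1 z : phi2 (phi1 z) 0 k1 = c1 * f1 z.
  by rewrite /phi2 set_coord_other // set_coord_same.
have phi_k2 z : phi2 (phi1 z) 0 k2 = c2 * f2 z.
  by rewrite /phi2 set_coord_same g2_indep.
have permE z i : (col_perm s \o (phi2 \o phi1)) z 0 i = phi2 (phi1 z) 0 (s i).
  by rewrite mxE.
apply: filterS nS => z ->; split=> [[f10 f20] i mi|z0].
  rewrite permE sE //; case: ifP => _; first by rewrite phi_k1 f10 mulr0.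
  by rewrite phi_k2 f20 mulr0.
have am : (m < m + 2)%N by rewrite addn2 ltnS leqnSn.
have bm : (m.+1 < m + 2)%N by rewrite addn2.
have := z0 (Ordinal am) (leqnn m); have := z0 (Ordinal bm) (leqnSn m).
rewrite !permE !sE //= eqxx gtn_eqF // phi_k1 phi_k2 => /eqP + /eqP.
by rewrite !mulf_eq0 (negbTE d1) (negbTE d2) /= => /eqP ? /eqP.
Qed.
End Charts.

(** * One-sided and spatial derivatives on the cylinder *)

Section CylinderDerivatives.
Context {R : realType}.

(** Near t the difference quotients G(s) / (s - t) are close to G'(t), hence
    nonzero. *)
Lemma isolated_zero (G : R -> R) t : derivable G t 1 -> derive1 G t <> 0 ->
  G t = 0 -> \forall s \near t, G s = 0 -> s = t.
Proof.
rewrite derive1E => dG G'0 Gt.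
have : \forall h \near 0^', h^-1 *: ((G \o shift t) (h *: 1) - G t) != 0.
  have c : h^-1 *: ((G \o shift t) (h *: 1) - G t) @[h --> 0^'] --> 'D_1 G t by exact: dG.
  have := c [set x : R | x != 0]; apply.
  apply: (open_near (U := [set x : R | x != 0]) (@open_neq R 0)).
  exact/eqP.
move=> /nbhs_ballP[d d0 dB]; apply/nbhs_ballP; exists d => // s sd Gs.
apply: contrapT => /eqP st.
have B0 : ball (0 : R) d (s - t).
  by move: sd; rewrite /ball /= sub0r opprB.
have st0 : s - t != 0 by rewrite subr_eq0.
have /= := dB _ B0 st0.
by rewrite Gt subr0 [(s - t)%:A]mulr1 subrK Gs scaler0 eqxx.
Qed.

Lemma within_proper (F : set_system R) (A : set R) :
  ProperFilter F -> F A -> ProperFilter (within A F).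
Proof.
move=> FF FA; apply: Build_ProperFilter_ex => P wP.
by have [x [Ax APx]] := filter_ex (filterI FA wP); exists x; apply: APx.
Qed.

Lemma row_mx_line n (x : 'rV[R]_n) (t h : R) :
  h *: delta_mx 0 (rshift n 0) + row_mx x t%:M = row_mx x (t + h)%:M.
Proof.
apply/rowP => j; rewrite !mxE eqxx /=; case: splitP => i ij.
  rewrite -val_eqE /= ij /= addn0 ltn_eqF ?mulr0 ?add0r //.
have -> : j = rshift n 0 by apply/val_inj; rewrite /= ij ord1.
by rewrite !mxE ord1 eqxx mulr1 !mulr1n addrC.
Qed.

(** At an interior time the restriction of the increments to I does not affect the
    limit. *)
Lemma derive_within_partial n (W : set 'rV[R]_(n + 1)) Fext (I : set R)
    (F : 'rV[R]_n -> R -> R) x t :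
  (forall x t, I t -> Fext (row_mx x t%:M) = F x t) ->
  W (row_mx x t%:M) -> Ck 1 W Fext -> nbhs t I ->
  derive_within I (F x) t = partial (rshift n 0) Fext (row_mx x t%:M).
Proof.
move=> FE Wx CF nI.
have It : I t by exact: nbhs_singleton nI.
have n0 : nbhs (0 : R) [set h | I (t + h)].
  have c : t + h @[h --> (0 : R)] --> t + 0.
    by apply: cvgD; [exact: cvg_cst|exact: cvg_id].
  by rewrite addr0 in c; exact: c.
have PF : ProperFilter (within [set h | I (t + h)] 0^').
  by apply: within_proper; exact: nbhs_dnbhs.
apply: cvg_lim => //.
have D := Ck_derivable (i := rshift n 0) CF Wx.
have c : h^-1 *: ((Fext \o shift (row_mx x t%:M)) (h *: delta_mx 0 (rshift n 0))
    - Fext (row_mx x t%:M)) @[h --> 0^'] --> partial (rshift n 0) Fext (row_mx x t%:M).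
  exact: D.
apply: cvg_trans (cvg_trans (cvg_app _ (@cvg_within _ 0^' _ [set h | I (t + h)])) c).
apply: near_eq_cvg; rewrite near_withinE; near=> h => /= Ith.
by rewrite row_mx_line !FE.
Unshelve. all: by end_near. Qed.

(** If all the spatial partial derivatives of Fext vanished at (x, t), those of
    the slice F(., t) would vanish at x, which would be critical. *)
Lemma exists_space_partial n (W : set 'rV[R]_(n + 1)) Fext (I : set R)
    (F : 'rV[R]_n -> R -> R) x t :
  (forall x t, I t -> Fext (row_mx x t%:M) = F x t) -> I t ->
  open W -> W (row_mx x t%:M) -> Ck 1 W Fext ->
  ~ critical_point (F ^~ t) x ->
  exists i, partial (lshift 1 i) Fext (row_mx x t%:M) != 0.
Proof.
move=> FE It oW Wx CF ncrit; apply: contrapT => np; apply: ncrit.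
have p0 i : partial (lshift 1 i) Fext (row_mx x t%:M) = 0.
  by apply/eqP; apply: contrapT => /negP ?; apply: np; exists i.
pose phi (y : 'rV[R]_n) := row_mx y t%:M : 'rV[R]_(n + 1).
have -> : F ^~ t = Fext \o phi by apply/funext => y; rewrite /= FE.
have phiE l : (fun y => phi y 0 (lshift 1 l)) = (fun y => y 0 l).
  by apply/funext => y; rewrite row_mxEl.
have phiE' l : (fun y => phi y 0 (rshift n l)) = cst (t%:M 0 l).
  by apply/funext => y; rewrite row_mxEr.
have Cphi k (U : set 'rV[R]_n) l : Ck k U (fun y => phi y 0 l).
  rewrite -(splitK l); case: (fintype.split l) => i /=.
    by rewrite phiE; exact: Ck_coord.
  by rewrite phiE'; exact: Ck_cst.
have oU : open (phi @^-1` W).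
  rewrite -[X in open X]setTI; apply: open_preimage_in => //; exact: openT.
have CFphi : Ck 1 (phi @^-1` W) (Fext \o phi).
  by apply: (Ck_comp oU oW _ CF).
apply: (critical_point_partial0 oU _ CFphi) => // i.
have D : is_derive x (delta_mx 0 i) (Fext \o phi)
   (\sum_l 'D_(delta_mx 0 i) (fun y => phi y 0 l) x * partial l Fext (phi x)).
  apply: (is_derive_comp (phi := phi) oW Wx CF) => [|l].
    by apply: continuous_rV => l; exact: (Ck_cont (Cphi 0 setT l)).
  exact: (Ck_derivable (Cphi 1 setT l)).
have [_ E] := D; rewrite [LHS]E big_split_ord /= !big1 ?addr0 // => l _.
  by rewrite phiE' derive_cst mul0r.
by rewrite p0 mulr0.
Qed.
End CylinderDerivatives.

(** * The fibered set *)

Section Fibered.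
Context {R : realType}.
Variables (m n : nat) (hnm : (n <= m)%N).

(** Positions in R^(m+2) of the coordinates of the factors R^n x R and
    R^(m-n+1). *)
Definition cyl_ord (j : 'I_(n + 1)) : 'I_(m + 2) :=
  cast_ord (total_dim hnm) (lshift (m - n + 1) j).
Definition fib_ord (j : 'I_(m - n + 1)) : 'I_(m + 2) :=
  cast_ord (total_dim hnm) (rshift (n + 1) j).
Definition time_ord := cyl_ord (rshift n 0).

Definition cyl_part (z : 'rV[R]_(m + 2)) : 'rV[R]_(n + 1) :=
  \row_j z 0 (cyl_ord j).
Definition space_part (z : 'rV[R]_(m + 2)) : 'rV[R]_n := lsubmx (cyl_part z).
Definition fib_part (z : 'rV[R]_(m + 2)) : 'rV[R]_(m - n + 1) :=
  \row_j z 0 (fib_ord j).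

Lemma cyl_ord_inj : injective cyl_ord.
Proof. by move=> i j /cast_ord_inj/lshift_inj. Qed.

Lemma fib_ord_inj : injective fib_ord.
Proof. by move=> i j /cast_ord_inj/rshift_inj. Qed.

Lemma cyl_fib_ord i j : cyl_ord i != fib_ord j.
Proof. by rewrite (inj_eq (@cast_ord_inj _ _ _)) eq_lrshift. Qed.

Lemma cyl_partE z : cyl_part z = row_mx (space_part z) (z 0 time_ord)%:M.
Proof.
rewrite -[LHS]hsubmxK; congr row_mx.
by apply/rowP => j; rewrite !mxE ord1 eqxx mulr1n.
Qed.

Lemma join_coordsE (z : 'rV[R]_(m + 2)) :
  z = join_coords hnm (space_part z) (z 0 time_ord) (fib_part z).
Proof.
rewrite /join_coords -cyl_partE; apply/rowP => i; rewrite castmxE.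
rewrite -[in LHS](cast_ordKV (total_dim hnm) i).
set j := cast_ord (esym _) i; rewrite -(splitK j).
by case: (fintype.split j) => l /=; rewrite ?row_mxEl ?row_mxEr mxE ?ord1.
Qed.

Lemma join_coordsK x t y : [/\ space_part (join_coords hnm x t y) = x,
  join_coords hnm x t y 0 time_ord = t & fib_part (join_coords hnm x t y) = y].
Proof.
have C j : join_coords hnm x t y 0 (cyl_ord j) = row_mx x t%:M 0 j.
  by rewrite /join_coords castmxE /cyl_ord cast_ordK ord1 row_mxEl.
split.
- by apply/rowP => j; rewrite !mxE C row_mxEl.
- by rewrite C row_mxEr mxE eqxx mulr1n.
- apply/rowP => j; rewrite mxE /join_coords castmxE /fib_ord cast_ordK ord1.
  by rewrite row_mxEr.
Qed.

Definition sphere_fun (G : R -> R) (z : 'rV[R]_(m + 2)) : R :=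
  G (z 0 time_ord) - \sum_j z 0 (fib_ord j) ^+ 2.

Lemma fibered_setE (I : set R) F G z : fibered_set hnm I F G z <->
  [/\ I (z 0 time_ord), F (space_part z) (z 0 time_ord) = 0 & sphere_fun G z = 0].
Proof.
split=> [[x [t [y [-> It Fxt Gt]]]]|[It Ft Gt]].
  have [E1 E2 E3] := join_coordsK x t y; rewrite E1 /sphere_fun E2; split=> //.
  rewrite -[RHS]Gt; congr (_ - _); apply: eq_bigr => j _.
  by rewrite -{2}E3 mxE.
exists (space_part z), (z 0 time_ord), (fib_part z); split=> //.
  exact: join_coordsE.
by rewrite -[RHS]Gt; congr (_ - _); apply: eq_bigr => j _; rewrite mxE.
Qed.

Lemma sphere_funE G : sphere_fun G = (fun z : 'rV[R]_(m + 2) => G (z 0 time_ord)) +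
  cst (-1) * \sum_j ((fun z : 'rV[R]_(m + 2) => z 0 (fib_ord j)) * (fun z => z 0 (fib_ord j))).
Proof.
apply/funext => z; rewrite -[RHS]/(_ + -1 * _) mulN1r fct_sumE.
by congr (_ - _).
Qed.

Lemma Ck_sphere_fun G k : smooth1 G -> Ck k setT (sphere_fun G).
Proof.
move=> sG; have oT := @openT 'rV[R]_(m + 2).
rewrite sphere_funE; apply: Ck_add => //; first exact: Ck_comp_coord.
apply: Ck_mul => //; first exact: Ck_cst.
by apply: Ck_sum => // j _; apply: Ck_mul => //; exact: Ck_coord.
Qed.

Lemma partial_sphere_fun G i z : smooth1 G -> partial i (sphere_fun G) z =
  derive1 G (z 0 time_ord) * (time_ord == i)%:R -
  \sum_j 2 * z 0 (fib_ord j) * (fib_ord j == i)%:R.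
Proof.
move=> sG; rewrite sphere_funE.
have dG := is_derive_comp_coord i (sG 0 (z 0 time_ord)).
have dsum := is_derive_sum (fun j => is_deriveM (is_derive_coord (fib_ord j) i z)
   (is_derive_coord (fib_ord j) i z)).
have [_ E] := is_deriveD dG (is_deriveM (is_derive_cst (-1 : R) z _) dsum).
rewrite [LHS]E scaler0 addr0; congr (_ + _).
rewrite -[LHS]/(-1 * _) mulN1r; congr (- _); apply: eq_bigr => j _.
by rewrite -mulr2n -[LHS]mulr_natl -[_ *: _]/(_ * _) mulrA.
Qed.

Lemma Ck_cyl_part k (U : set 'rV[R]_(m + 2)) l : Ck k U (fun z => cyl_part z 0 l).
Proof. by rewrite /cyl_part row_coordE; exact: Ck_coord. Qed.

Lemma partial_cyl_part (W : set 'rV[R]_(n + 1)) f j z : open W -> W (cyl_part z) ->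
  Ck 1 W f -> partial (cyl_ord j) (f \o cyl_part) z = partial j f (cyl_part z).
Proof.
move=> oW Wz Cf.
have D : is_derive z (delta_mx 0 (cyl_ord j)) (f \o cyl_part)
  (\sum_l 'D_(delta_mx 0 (cyl_ord j)) (fun z => cyl_part z 0 l) z * partial l f (cyl_part z)).
  apply: (is_derive_comp oW Wz Cf) => [|l].
    by apply: continuous_rV => l; exact: (Ck_cont (Ck_cyl_part 0 setT l)).
  exact: (Ck_derivable (Ck_cyl_part 1 setT l)).
have [_ E] := D; rewrite [LHS]E (bigD1 j) //= big1 => [|l lj].
  rewrite addr0 /cyl_part row_coordE.
  have [_ ->] := is_derive_coord (cyl_ord j) (cyl_ord j) z.
  by rewrite eqxx mul1r.
rewrite /cyl_part row_coordE.
have [_ ->] := is_derive_coord (cyl_ord l) (cyl_ord j) z.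
by rewrite (inj_eq cyl_ord_inj) (negbTE lj) mul0r.
Qed.

Lemma cyl_part_set_coord_fib j c z : cyl_part (set_coord (fib_ord j) c z) = cyl_part z.
Proof. by apply/rowP => l; rewrite !mxE (negbTE (cyl_fib_ord _ _)). Qed.

Lemma sphere_fun_set_coord_space G j c z :
  sphere_fun G (set_coord (cyl_ord (lshift 1 j)) c z) = sphere_fun G z.
Proof.
rewrite /sphere_fun set_coord_other; last by rewrite (inj_eq cyl_ord_inj) eq_rlshift.
by congr (_ - _); apply: eq_bigr => l _; rewrite set_coord_other // eq_sym cyl_fib_ord.
Qed.

(** The common core of the two assertions: an end point of I enters only as a time
    t in I with G(t) = 0. *)
Lemma fibered_set_submanifold (I : set R) F G :
  smooth_on_cylinder I F -> smooth1 G ->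
  (forall t, 0 < G t -> I t) ->
  (forall t, I t -> 0 < G t -> nbhs t I) ->
  (forall t, I t -> G t = 0 -> derive1 G t <> 0 /\
     forall x, F x t = 0 -> ~ critical_point (F ^~ t) x) ->
  (forall x t, I t -> derive_within I (F x) t <> 0) ->
  smooth_submanifold m (fibered_set hnm I F G).
Proof.
move=> [W [Fext [oW WI sF FE]]] sG Gpos Gint Gend Fder.
have CF k : Ck k W Fext by exact: ((smooth_onP _ _).1 sF).
have oW' : open (cyl_part @^-1` W).
  rewrite -[X in open X]setTI; apply: open_preimage_in => //; first exact: openT.
  by move=> l; exact: Ck_cyl_part.
have CFc k : Ck k (cyl_part @^-1` W) (Fext \o cyl_part).
  by apply: (Ck_comp oW' oW _ (CF k)) => // l; exact: Ck_cyl_part.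
have FcE (z : 'rV[R]_(m + 2)) :
    I (z 0 time_ord) -> (Fext \o cyl_part) z = F (space_part z) (z 0 time_ord).
  by move=> Iz; rewrite /= cyl_partE FE.
have near_time (p : 'rV[R]_(m + 2)) (A : set R) :
    nbhs (p 0 time_ord) A -> nbhs p [set z : 'rV[R]_(m + 2) | A (z 0 time_ord)].
  move=> nA; have c : (z : 'rV[R]_(m + 2)) 0 time_ord @[z --> p]
      --> p 0 time_ord.
    exact: coord_continuous.
  exact: c.
apply: two_equations_submanifold => p /fibered_setE[Ip Fp Gp].
have Wp : W (cyl_part p) by rewrite cyl_partE; exact: WI.
have sum_ge0 (z : 'rV[R]_(m + 2)) : 0 <= \sum_j z 0 (fib_ord j) ^+ 2.
  by apply: sumr_ge0 => j _; exact: sqr_ge0.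
have Ge0 (z : 'rV[R]_(m + 2)) : sphere_fun G z = 0 -> 0 <= G (z 0 time_ord).
  by move=> /eqP; rewrite subr_eq0 => /eqP ->; exact: sum_ge0.
have := Ge0 p Gp; rewrite le_eqVlt => /orP[/eqP/esym Gp0|Gp_gt0].
- have [G'0 ncrit] := Gend _ Ip Gp0.
  (* End point: solve F = 0 for x_i, then the other equation for t. *)
  have [i di] := exists_space_partial FE Ip oW (WI (space_part p) _ Ip)
    (CF 1%N) (ncrit _ Fp).
  exists (Fext \o cyl_part), (sphere_fun G), (cyl_ord (lshift 1 i)), time_ord.
  exists (cyl_part @^-1` W), setT; split.
    by rewrite (inj_eq cyl_ord_inj) eq_lrshift.
  split=> //.
  + split=> //; rewrite (partial_cyl_part _ oW Wp (CF 1%N)) cyl_partE; exact: di.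
  + split=> //; [exact: openT|by move=> k; exact: Ck_sphere_fun|].
    rewrite partial_sphere_fun // eqxx mulr1 big1 ?subr0; first exact/eqP.
    by move=> j _; rewrite eq_sym (negbTE (cyl_fib_ord _ _)) mulr0.
  + by move=> c z; exact: sphere_fun_set_coord_space.
  + have nz := isolated_zero (sG 0 _) G'0 Gp0.
    apply: filterS (near_time _ _ nz) => z zp.
    split=> [/fibered_setE[Iz Fz Gz]|[Fz Gz]]; first by rewrite FcE.
    have Iz : I (z 0 time_ord).
      have := Ge0 z Gz; rewrite le_eqVlt => /orP[/eqP/esym/zp -> //|]; exact: Gpos.
    by apply/fibered_setE; split=> //; rewrite -FcE.
- (* Interior time: solve for y_j, then F = 0 for t. *)
  have [j yj] : exists j, p 0 (fib_ord j) != 0.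
    apply: contrapT => ny; move: Gp_gt0.
    move/eqP: Gp; rewrite subr_eq0 => /eqP ->; rewrite big1 ?ltxx // => j _.
    by have [->|yj] := eqVneq (p 0 (fib_ord j)) 0; [rewrite expr0n|case: ny; exists j].
  have nI := Gint _ Ip Gp_gt0.
  exists (sphere_fun G), (Fext \o cyl_part), (fib_ord j), time_ord.
  exists setT, (cyl_part @^-1` W); split; first by rewrite eq_sym cyl_fib_ord.
  split=> //.
  + split=> //; [exact: openT|by move=> k; exact: Ck_sphere_fun|].
    rewrite partial_sphere_fun // (negbTE (cyl_fib_ord _ _)) mulr0 sub0r oppr_eq0.
    rewrite (bigD1 j) //= big1 ?addr0 ?eqxx ?mulr1 ?mulf_neq0 ?pnatr_eq0 //.
    by move=> l lj; rewrite (inj_eq fib_ord_inj) (negbTE lj) mulr0.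
  + split=> //; rewrite (partial_cyl_part _ oW Wp (CF 1%N)) cyl_partE.
    rewrite -(derive_within_partial FE (WI _ _ Ip) (CF 1%N) nI).
    exact/eqP/Fder.
  + by move=> c z; rewrite /= cyl_part_set_coord_fib.
  + by move=> c z; rewrite /= cyl_part_set_coord_fib.
  + apply: filterS (near_time _ _ nI) => z Iz.
    rewrite fibered_setE -FcE //; split=> [[]|[]]; split=> //.
Qed.
End Fibered.

Theorem theorem3 (R : realType) (m n : nat) (hn : (1 <= n)%N)
  (hnm : (n <= m)%N)
  (D : set 'rV[R]_n) (J : finType) (S : J -> set 'rV[R]_n)
  (hD : open D)
  (hbd : closure D `\` D = \bigcup_(j in [set: J]) S j)
  (hdisj : trivIset [set: J] S)
  (hSmfd : forall j : J, smooth_submanifold (n - 1) (S j))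
  (hScomp : forall j : J, exists g : 'rV[R]_n -> R,
     [/\ smooth_on [set: 'rV[R]_n] g,
         finite_union_of_components (zero_set g) (S j)
       & forall x, S j x -> ~ critical_point g x])
  (I : set R)
  (hI : (exists a1 a2 : R, a1 < a2 /\ I = `[a1, a2]%classic) \/
        (exists a : R, I = `[a, +oo[%classic))
  (F : 'rV[R]_n -> R -> R)
  (hF : smooth_on_cylinder I F)
  (* (i) *)
  (h_i : closure D = [set x | exists2 t, I t & F x t = 0])
  (* (ii) *)
  (h_ii : forall t1 t2 : R, I t1 -> I t2 -> t1 <> t2 ->
     zero_set (F ^~ t1) `&` zero_set (F ^~ t2) = set0)
  (h_ii_bounded : forall a1 a2 : R, a1 < a2 -> I = `[a1, a2]%classic ->
     (exists J1 J2 : set J,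
        [/\ J1 `|` J2 = [set: J], J1 `&` J2 = set0,
            zero_set (F ^~ a1) = \bigcup_(j in J1) S j
          & zero_set (F ^~ a2) = \bigcup_(j in J2) S j]) /\
     (forall x, zero_set (F ^~ a1) x -> ~ critical_point (F ^~ a1) x) /\
     (forall x, zero_set (F ^~ a2) x -> ~ critical_point (F ^~ a2) x))
  (h_ii_unbounded : forall a : R, I = `[a, +oo[%classic ->
     zero_set (F ^~ a) = \bigcup_(j in [set: J]) S j /\
     (forall x, zero_set (F ^~ a) x -> ~ critical_point (F ^~ a) x))
  (* (iii) *)
  (h_iii : forall (x0 : 'rV[R]_n) (t0 : R), I t0 ->
     derive_within I (F x0) t0 <> 0) :
  (* (1) *)
  (forall (a : R) (G : R -> R), I = `[a, +oo[%classic -> smooth1 G ->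
     [set t | 0 < G t] = I `\ a -> G a = 0 -> derive1 G a <> 0 ->
     smooth_submanifold m (fibered_set hnm I F G)) /\
  (* (2) *)
  (forall (a1 a2 : R) (G : R -> R), a1 < a2 -> I = `[a1, a2]%classic -> smooth1 G ->
     [set t | 0 < G t] = I `\` [set a1; a2] ->
     G a1 = 0 -> G a2 = 0 -> derive1 G a1 <> 0 -> derive1 G a2 <> 0 ->
     smooth_submanifold m (fibered_set hnm I F G)).
Proof.
split=> [a G IE sG Gpos Ga G'a|a1 a2 G a12 IE sG Gpos Ga1 Ga2 G'a1 G'a2].
- have [_ ncrit] := h_ii_unbounded a IE.
  have posE t : (0 < G t) = (I t /\ t <> a) :> Prop.
    by rewrite -[LHS]/([set t | 0 < G t] t) Gpos.
  apply: fibered_set_submanifold => //.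
  + by move=> t; rewrite -[is_true _]/(0 < G t : Prop) posE => -[].
  + move=> t; rewrite IE /= in_itv /= andbT le_eqVlt => /orP[/eqP <-|at_ _].
      by rewrite Ga ltxx.
    have at' : t \in `]a, +oo[ by rewrite in_itv /= andbT.
    apply: filterS (open_near (@rray_open _ R a) at') => s.
    by rewrite /= !in_itv /= !andbT => /ltW.
  + move=> t It Gt.
    have -> : t = a.
      apply: contrapT => ta; have : is_true (0 < G t) by rewrite posE.
      by rewrite Gt ltxx.
    by split=> // x; exact: ncrit.
- have [_ [ncrit1 ncrit2]] := h_ii_bounded a1 a2 a12 IE.
  have posE t : (0 < G t) = (I t /\ ~ (t = a1 \/ t = a2)) :> Prop.
    by rewrite -[LHS]/([set t | 0 < G t] t) Gpos.
  apply: fibered_set_submanifold => //.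
  + by move=> t; rewrite -[is_true _]/(0 < G t : Prop) posE => -[].
  + move=> t; rewrite IE /= in_itv /= !le_eqVlt => /andP[/orP[/eqP <-|t1] /orP[/eqP ->|t2]];
      rewrite ?Ga1 ?Ga2 ?ltxx // => _.
    have at' : t \in `]a1, a2[ by rewrite in_itv /= t1.
    apply: filterS (open_near (@itv_open _ R a1 a2) at') => s.
    by rewrite /= !in_itv /= => /andP[/ltW -> /ltW ->].
  + move=> t It Gt.
    have [->|->] : t = a1 \/ t = a2.
      apply: contrapT => ta; have : is_true (0 < G t) by rewrite posE.
      by rewrite Gt ltxx.
    * by split=> // x; exact: ncrit1.
    * by split=> // x; exact: ncrit2.
Qed.
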